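(* Let $K$ be a field (of arbitrary characteristic), $n\ge 1$, $X=(X_1,\ldots,X_n)$, and let $F=(F_1,\ldots,F_n)\in K[[X]]^n$ be such that $F(0)=0$ and $F(X)=X+H(X)$, where $H=(H_1,\ldots,H_n)$ and the order of vanishing $t_i=\operatorname{ord}(H_i)$ of each $H_i$ is strictly greater than $1$. Let $G:=F^{-1}\in K[[X]]^n$ be the formal inverse of $F$. Let $(P_k)_{k\ge 0}$ be the sequence in $K[[X]]^n$ defined by $P_0(X)=X$ and $P_{k+1}=P_k\circ F-P_k$ for $k\ge 0$. Put $A_m=\sum_{k=0}^{m-1}(-1)^kP_k(X)$ for $m\ge 1$ and $A=\sum_{k=0}^{\infty}(-1)^kP_k(X)$ (the limit of the convergent sequence $(A_m)$). Then $A=G$.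
   Context: $K[[X]]$ is the ring of formal power series in $X_1,\ldots,X_n$ over $K$. For $\Phi\in K[[X]]$ with decomposition $\Phi=\sum_{q\ge 0}\Phi_q$ into homogeneous components ($\Phi_q$ homogeneous of degree $q$), the order of vanishing is $\operatorname{ord}(\Phi)=\min\{q:\Phi_q\ne 0\}$ for $\Phi\neq 0$, and $\operatorname{ord}(0)=\infty$. For $\Phi\in K[[X]]$, $\Phi\circ F=\Phi(F_1,\ldots,F_n)$ (well defined since $F(0)=0$); composition of tuples is componentwise. Convergence and infinite sums in $K[[X]]^n$ are understood componentwise in the $I$-adic topology of $K[[X]]$, where $I=(X_1,\ldots,X_n)$ (so $\Phi^{(m)}\to\Phi$ iff $\operatorname{ord}(\Phi^{(m)}-\Phi)\to\infty$); the sequence $(A_m)$ converges in this sense. The formal inverse $G$ of $F$ is the unique $G\in K[[X]]^n$ with $G(0)=0$ and $G\circ F(X)=X$; it also satisfies $F\circ G(X)=X$. *)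

(* Defs.v *)
From HB Require Import structures.
From mathcomp Require Import all_boot all_order all_algebra.
From mathcomp Require Import boolp.
From mathcomp Require Import mpoly.

Set Implicit Arguments.
Unset Strict Implicit.
Unset Printing Implicit Defensive.

Import GRing.Theory.
Local Open Scope ring_scope.

(* The ring R[[X_1, ..., X_n]]: a series is the family of its coefficients,
   indexed by the multi-exponents m : 'X_{1..n} (of total degree mdeg m). *)

Record fps (R : Type) (n : nat) := Fps { fpscoef : 'X_{1..n} -> R }.

Section FpsRing.
Variables (R : comNzRingType) (n : nat).
Implicit Types (f g h : fps R n) (m : 'X_{1..n}).

Lemma fpsP f g : (forall m, fpscoef f m = fpscoef g m) <-> f = g.
Proof.
split=> [|-> //]; case: f g => [f] [g] /= fg.
by congr Fps; apply: funext.
Qed.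

HB.instance Definition _ := gen_eqMixin (fps R n).
HB.instance Definition _ := gen_choiceMixin (fps R n).

Definition fps_const (c : R) : fps R n :=
  Fps (fun m => if m == 0%MM then c else 0).
Definition fps_add f g := Fps (fun m => fpscoef f m + fpscoef g m).
Definition fps_opp f := Fps (fun m => - fpscoef f m).
Definition fps_scale (a : R) f := Fps (fun m => a * fpscoef f m).

(* Cauchy product: the sum over all decompositions m = k.1 + k.2; the degree
   bound on k.1 and k.2 is implied by that equality, and only makes the index
   type finite. *)
Definition fps_mul f g := Fps (fun m =>
  \sum_(k : 'X_{1..n < (mdeg m).+1, (mdeg m).+1} | m == (k.1 + k.2)%MM)
     fpscoef f k.1 * fpscoef g k.2).

Fact fps_addA : associative fps_add.
Proof. by move=> f g h; apply/fpsP=> m /=; rewrite addrA. Qed.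

Fact fps_addC : commutative fps_add.
Proof. by move=> f g; apply/fpsP=> m /=; rewrite addrC. Qed.

Fact fps_add0 : left_id (fps_const 0) fps_add.
Proof. by move=> f; apply/fpsP=> m /=; rewrite if_same add0r. Qed.

Fact fps_addN : left_inverse (fps_const 0) fps_opp fps_add.
Proof. by move=> f; apply/fpsP=> m /=; rewrite if_same addNr. Qed.

HB.instance Definition _ := GRing.isZmodule.Build (fps R n)
  fps_addA fps_addC fps_add0 fps_addN.

(* The ring laws are transferred from polynomials by truncation. *)

Definition fps_trunc (d : nat) f : {mpoly R[n]} :=
  \sum_(m : 'X_{1..n < d.+1}) fpscoef f m *: 'X_[m].

Lemma fps_truncE d f m : (mdeg m <= d)%N -> (fps_trunc d f)@_m = fpscoef f m.
Proof. by move=> md; rewrite /fps_trunc mcoeff_mpoly. Qed.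

Lemma fps_mulE d f g m : (mdeg m <= d)%N ->
  fpscoef (fps_mul f g) m = (fps_trunc d f * fps_trunc d g)@_m.
Proof.
move=> md; rewrite mcoeffM /=; apply: eq_bigr => k _.
by rewrite !fps_truncE // (leq_trans _ md) // -ltnS bmdeg.
Qed.

Lemma mcoeffM_eq (p p' q q' : {mpoly R[n]}) m :
    (forall k, (mdeg k <= mdeg m)%N -> p@_k = p'@_k) ->
    (forall k, (mdeg k <= mdeg m)%N -> q@_k = q'@_k) ->
  (p * q)@_m = (p' * q')@_m.
Proof.
move=> pp qq; rewrite !mcoeffM; apply: eq_bigr => k _.
by rewrite pp ?qq // -ltnS bmdeg.
Qed.

Fact fps_mulA : associative fps_mul.
Proof.
move=> f g h; apply/fpsP=> m; rewrite !(@fps_mulE (mdeg m)) //.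
set T := fps_trunc _.
have -> : (T f * T (fps_mul g h))@_m = (T f * (T g * T h))@_m.
  by apply: mcoeffM_eq => // k km; rewrite fps_truncE // (fps_mulE _ _ km).
have -> : (T (fps_mul f g) * T h)@_m = (T f * T g * T h)@_m.
  by apply: mcoeffM_eq => // k km; rewrite fps_truncE // (fps_mulE _ _ km).
by rewrite mulrA.
Qed.

Fact fps_mulC : commutative fps_mul.
Proof.
by move=> f g; apply/fpsP=> m; rewrite !(@fps_mulE (mdeg m)) // mulrC.
Qed.

Fact fps_mul1 : left_id (fps_const 1) fps_mul.
Proof.
move=> f; apply/fpsP=> m; rewrite (@fps_mulE (mdeg m)) //.
rewrite -(fps_truncE f (leqnn (mdeg m))) -[in RHS](mul1r (fps_trunc _ f)).
apply: mcoeffM_eq => // k km; rewrite fps_truncE //= mcoeff1.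
by case: eqP.
Qed.

Fact fps_mulDl : left_distributive fps_mul fps_add.
Proof.
move=> f g h; apply/fpsP=> m /=; rewrite -big_split /=.
by apply: eq_bigr => k _; rewrite mulrDl.
Qed.

Fact fps_1neq0 : fps_const 1 != 0.
Proof.
apply/eqP=> /fpsP /(_ 0%MM) /=; rewrite eqxx; exact/eqP/oner_neq0.
Qed.

HB.instance Definition _ := GRing.Zmodule_isComNzRing.Build (fps R n)
  fps_mulA fps_mulC fps_mul1 fps_mulDl fps_1neq0.

Fact fps_scaleA a b f : fps_scale a (fps_scale b f) = fps_scale (a * b) f.
Proof. by apply/fpsP=> m /=; rewrite mulrA. Qed.

Fact fps_scale1 : left_id 1 fps_scale.
Proof. by move=> f; apply/fpsP=> m /=; rewrite mul1r. Qed.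

Fact fps_scaleDr : right_distributive fps_scale +%R.
Proof. by move=> a f g; apply/fpsP=> m /=; rewrite mulrDr. Qed.

Fact fps_scaleDl f : {morph fps_scale^~ f : a b / a + b}.
Proof. by move=> a b; apply/fpsP=> m /=; rewrite mulrDl. Qed.

HB.instance Definition _ := GRing.Zmodule_isLmodule.Build R (fps R n)
  fps_scaleA fps_scale1 fps_scaleDr fps_scaleDl.

End FpsRing.

Section Order.
Variables (R : comNzRingType) (n : nat).
Implicit Types (f g : fps R n).

Definition fps_hcomp (q : nat) f : fps R n :=
  Fps (fun m => if mdeg m == q then fpscoef f m else 0).

(* Some q stands for the finite order q and None for infinity. *)
Definition fps_ord f : option nat :=
  match pselect (exists q, fps_hcomp q f != 0) with
  | left ex => Some (ex_minn ex)
  | right _ => None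
  end.

Definition lt_ord (N : nat) (o : option nat) : bool :=
  if o is Some q then (N < q)%N else true.

Lemma lt_ordP N f :
  lt_ord N (fps_ord f) <-> (forall m, (mdeg m <= N)%N -> fpscoef f m = 0).
Proof.
have hc0 q : (fps_hcomp q f == 0) <-> (forall m, mdeg m = q -> fpscoef f m = 0).
  split=> [/eqP/fpsP f0 m mq|f0]; last first.
    by apply/eqP/fpsP=> m /=; rewrite if_same; case: eqP => // /f0.
  by have := f0 m; rewrite /= mq eqxx if_same.
rewrite /fps_ord; case: pselect => [ex|nex] /=.
  case: ex_minnP => q fq minq; split=> [Nq m mN|f0].
    have /hc0-> // : fps_hcomp (mdeg m) f == 0.
    apply/negPn/negP => /minq; rewrite leqNgt (leq_ltn_trans mN Nq) //.
  rewrite ltnNge; apply/negP => qN; move/negP: fq; apply.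
  by apply/hc0 => m mq; apply: f0; rewrite mq.
split=> // _ m _; have /hc0-> // : fps_hcomp (mdeg m) f == 0.
by apply/negPn/negP => fm; apply: nex; exists (mdeg m).
Qed.

(* Convergence in the (X_1, ..., X_n)-adic topology: ord (u k - f) -> oo. *)
Definition fps_cvg (u : nat -> fps R n) (f : fps R n) : Prop :=
  forall N, exists M, forall k, (M <= k)%N -> lt_ord N (fps_ord (u k - f)).

Lemma fps_cvg_unique u f g : fps_cvg u f -> fps_cvg u g -> f = g.
Proof.
move=> uf ug; apply/fpsP=> m.
have [M1 /(_ (maxn M1 _) (leq_maxl _ _))/lt_ordP uf1] := uf (mdeg m).
have [M2 /(_ (maxn M1 M2) (leq_maxr _ _))/lt_ordP ug2] := ug (mdeg m).
have /= /subr0_eq <- := uf1 M2 m (leqnn _).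
by have /= /subr0_eq <- := ug2 m (leqnn _).
Qed.

End Order.

Section Composition.
Variables (R : comNzRingType) (n : nat).
Implicit Types (f : fps R n) (F G : {ffun 'I_n -> fps R n}).

Definition fps_monom F (a : 'X_{1..n}) : fps R n := \prod_(i < n) F i ^+ a i.

(* f(F_1, ..., F_n) = \sum_a f_a F^a for F(0) = 0: since ord (F^a) >= |a|, the
   coefficient at m only involves the exponents a with |a| <= |m|. The result
   is meaningful only when F(0) = 0, see fps_compP. *)
Definition fps_comp f F : fps R n := Fps (fun m =>
  \sum_(a : 'X_{1..n < (mdeg m).+1}) fpscoef f a * fpscoef (fps_monom F a) m).

Definition fps_vanish0 F : Prop := forall i, fpscoef (F i) 0%MM = 0.

Lemma fpscoefM_small f g d e m :
    (forall k, (mdeg k < d)%N -> fpscoef f k = 0) ->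
    (forall k, (mdeg k < e)%N -> fpscoef g k = 0) ->
  (mdeg m < d + e)%N -> fpscoef (f * g) m = 0.
Proof.
move=> f0 g0 mde; apply: big1 => k /eqP mE.
have [/f0 ->|dk] := ltnP (mdeg k.1) d; first by rewrite mul0r.
rewrite [X in _ * X]g0 ?mulr0 //.
rewrite mE mdegD in mde.
by rewrite -(ltn_add2l d) (leq_ltn_trans _ mde) // leq_add2r.
Qed.

Lemma fps_monom_small F a m : fps_vanish0 F ->
  (mdeg m < mdeg a)%N -> fpscoef (fps_monom F a) m = 0.
Proof.
move=> F0; rewrite (mdegE a) /fps_monom.
pose P (d : nat) f := forall m, (mdeg m < d)%N -> fpscoef f m = 0.
suff : P (\sum_i a i)%N (\prod_(i < n) F i ^+ a i) by apply.
apply: (big_ind2 P); rewrite {}/P.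
- by [].
- by move=> d f e g f0 g0 k; apply: fpscoefM_small.
move=> i _.
elim: (a i) => [//|e IH] {}m; rewrite exprS -(add1n e).
apply: fpscoefM_small => // k; rewrite ltnS leqn0 mdeg_eq0 => /eqP ->.
exact: F0.
Qed.

Lemma fps_coef_sum (I : Type) (s : seq I) (P : pred I) (u : I -> fps R n) m :
  fpscoef (\sum_(i <- s | P i) u i) m = \sum_(i <- s | P i) fpscoef (u i) m.
Proof.
elim/big_rec2: _ => [|i x y _ <- //]; exact: if_same.
Qed.

Lemma fps_compP f F : fps_vanish0 F ->
  fps_cvg (fun d => \sum_(a : 'X_{1..n < d}) fpscoef f a *: fps_monom F a)
          (fps_comp f F).
Proof.
move=> F0 N; exists N.+1 => d Nd; apply/lt_ordP => m mN /=.
rewrite fps_coef_sum; apply/eqP; rewrite subr_eq0; apply/eqP => /=.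
have md : ((mdeg m).+1 <= d)%N by apply: leq_trans Nd.
rewrite (bigID (fun a : 'X_{1..n < d} => (mdeg a < (mdeg m).+1)%N)) /=.
rewrite [X in _ + X]big1 ?addr0; last first.
  by move=> a; rewrite -leqNgt => ma; rewrite fps_monom_small ?mulr0.
pose w (a : 'X_{1..n < (mdeg m).+1}) : 'X_{1..n < d} :=
  BMultinom (leq_trans (bmdeg a) md).
pose a0 : 'X_{1..n < (mdeg m).+1} := BMultinom (ltnSn (mdeg m)).
rewrite (reindex_onto w (fun a => insubd a0 (bmnm a))) /=; last first.
  by move=> a ma; apply/val_inj; rewrite /= insubdK.
apply: eq_bigl => a; rewrite bmdeg /=.
by apply/eqP/val_inj; rewrite insubdK // unfold_in bmdeg.
Qed.

Definition tuple_comp G F : {ffun 'I_n -> fps R n} :=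
  [ffun i => fps_comp (G i) F].

(* U_(i) is the exponent of the monomial X_i. *)
Definition fps_var (i : 'I_n) : fps R n :=
  Fps (fun m => (m == U_(i)%MM)%:R).

Definition tuple_var : {ffun 'I_n -> fps R n} := [ffun i => fps_var i].

(* These two conditions characterize G uniquely when F = X + (order > 1). *)
Definition formal_inverse F G : Prop :=
  fps_vanish0 G /\ tuple_comp G F = tuple_var.

Definition tuple_cvg (u : nat -> {ffun 'I_n -> fps R n})
    (A : {ffun 'I_n -> fps R n}) : Prop :=
  forall i, fps_cvg (fun m => u m i) (A i).

Fixpoint Pseq F (k : nat) : {ffun 'I_n -> fps R n} :=
  if k is k'.+1 then tuple_comp (Pseq F k') F - Pseq F k' else tuple_var.

Definition Asum F (m : nat) : {ffun 'I_n -> fps R n} :=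
  \sum_(k < m) (-1 : R) ^+ k *: Pseq F k.

End Composition.

(* Main.v *)
(** Write [T f = f o F] and [D = T - 1], so that [P_k = D^k X] and the
    alternating sum telescopes to [A_m o F = X - (-1)^m P_m]; hence
    [(A_m - G) o F = - (-1)^m P_m]. As [F = X + (order > 1)], the monomials
    [F^a] and [X^a] agree up to degree [|a|], so [D] strictly raises the order
    of vanishing. This gives [ord P_m > m], and it also shows that [T = 1 + D]
    preserves orders, whence [ord (A_m - G) > m]. *)
Require Import Defs.
From mathcomp Require Import all_boot all_order all_algebra.
From mathcomp Require Import mpoly.
Import GRing.Theory.
Local Open Scope ring_scope.

Section UnipotentSubstitution.
Variables (R : comNzRingType) (n : nat).
Implicit Types (f g : fps R n) (F G : {ffun 'I_n -> fps R n}).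

Definition vanish_below (d : nat) f : Prop :=
  forall m, (mdeg m < d)%N -> fpscoef f m = 0.

(** In other words, [f] is [X^e] plus terms of degree greater than [mdeg e]; no other monomial of
    degree [mdeg e] is allowed. *)
Definition leading_monom (e : 'X_{1..n}) f : Prop :=
  forall m, (mdeg m <= mdeg e)%N -> fpscoef f m = (e == m)%:R.

Definition tangent_to_id F : Prop := forall i, leading_monom U_(i)%MM (F i).

Lemma leading_monom1 : leading_monom 0%MM (1 : fps R n).
Proof. by move=> m _; rewrite eq_sym /=; case: eqP. Qed.

Lemma leading_monom_below e f m :
  leading_monom e f -> (mdeg m < mdeg e)%N -> fpscoef f m = 0.
Proof.
move=> ef me; rewrite ef 1?ltnW //; case: eqP => // em.
by rewrite em ltnn in me.
Qed.

Lemma leading_monomM e1 e2 f g :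
  leading_monom e1 f -> leading_monom e2 g -> leading_monom (e1 + e2)%MM (f * g).
Proof.
move=> ef eg m; rewrite mdegD => me.
(* The right side becomes a coefficient of the polynomial product [X^e1 * X^e2], so the two Cauchy
   sums can be compared term by term. *)
rewrite -(mcoeffX R) mpolyXD mcoeffM; apply: eq_bigr => k /eqP mE.
have {}me : (mdeg k.1 + mdeg k.2 <= mdeg e1 + mdeg e2)%N.
  by rewrite -mdegD -mE.
rewrite !mcoeffX.
have below (u v : 'X_{1..n}) : (mdeg u < mdeg v)%N -> (v == u) = false.
  by move=> uv; apply/eqP => vu; rewrite vu ltnn in uv.
(* By the bound [me], either one factor lies below its leading degree and both terms vanish, or both
   factors are in the range where [ef] and [eg] apply. *)
have [k1|k1|k1] := ltngtP (mdeg k.1) (mdeg e1).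
- by rewrite (leading_monom_below _ _ _ ef k1) below // !mul0r.
- have k2 : (mdeg k.2 < mdeg e2)%N.
    by rewrite -(ltn_add2l (mdeg e1)) (leq_trans _ me) // ltn_add2r.
  by rewrite (leading_monom_below _ _ _ eg k2) (below _ _ k2) !mulr0.
- by rewrite ef ?k1 // eg // -(leq_add2l (mdeg e1)) -{1}k1.
Qed.

Lemma leading_monom_exp e f k :
  leading_monom e f -> leading_monom (e *+ k)%MM (f ^+ k).
Proof.
move=> ef; elim: k => [|k IH]; first by rewrite mulm0n; exact: leading_monom1.
by rewrite exprS mulmS; apply: leading_monomM.
Qed.

Lemma leading_fps_monom F a :
  tangent_to_id F -> leading_monom a (fps_monom F a).
Proof.
move=> tF; rewrite {1}(multinomUE_id a) /fps_monom.
apply: (big_ind2 leading_monom); first exact: leading_monom1.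
  by move=> e1 f e2 g; apply: leading_monomM.
by move=> i _; apply: leading_monom_exp.
Qed.

Lemma fps_compD f g F : fps_comp (f + g) F = fps_comp f F + fps_comp g F.
Proof.
apply/fpsP=> m /=; rewrite -big_split /=.
by apply: eq_bigr => a _; rewrite mulrDl.
Qed.

Lemma fps_compZ c f F : fps_comp (c *: f) F = c *: fps_comp f F.
Proof.
apply/fpsP=> m /=; rewrite big_distrr /=.
by apply: eq_bigr => a _; rewrite mulrA.
Qed.

Lemma vanish_comp_sub d f F : tangent_to_id F ->
  vanish_below d f -> vanish_below d.+1 (fps_comp f F - f).
Proof.
move=> tF f0 m; rewrite ltnS => md /=.
apply/eqP; rewrite subr_eq0; apply/eqP.
(* The term [a = m] contributes exactly the coefficient of [f] at [m]. Any other [a] has [f_a = 0]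
   if [mdeg a < d]; otherwise [mdeg m <= mdeg a] and [F^a] has coefficient 0 at [m]. *)
rewrite (bigD1 (BMultinom (ltnSn (mdeg m)))) //= big1 => [|a am].
  by rewrite (leading_fps_monom _ _ tF) // eqxx mulr1 addr0.
have [/f0 -> |da] := ltnP (mdeg a) d; first by rewrite mul0r.
rewrite (leading_fps_monom _ _ tF) ?(leq_trans md) //.
case: (bmnm a =P m) => [ma|]; last by rewrite mulr0.
by case/eqP: am; apply/val_inj.
Qed.

Lemma vanish_belowD d f g :
  vanish_below d f -> vanish_below d g -> vanish_below d (f + g).
Proof. by move=> f0 g0 m md /=; rewrite f0 // g0 // addr0. Qed.

Lemma vanish_belowZ d c f : vanish_below d f -> vanish_below d (c *: f).
Proof. by move=> f0 m md /=; rewrite f0 // mulr0. Qed.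

Lemma vanish_below_le d e f :
  (d <= e)%N -> vanish_below e f -> vanish_below d f.
Proof. by move=> de f0 m md; apply: f0; apply: leq_trans de. Qed.

Lemma vanish_comp_inv d f F : tangent_to_id F ->
  vanish_below d (fps_comp f F) -> vanish_below d f.
Proof.
move=> tF fF0; suff : forall e, (e <= d)%N -> vanish_below e f by apply.
elim=> [//|e IH] ed.
(* Bootstrapping with [f = T f - D f]: if [f] vanishes below [e], then [D f] vanishes below [e.+1],
   and so does [T f] as long as [e < d]. *)
have -> : f = fps_comp f F + (-1) *: (fps_comp f F - f).
  by rewrite scaleN1r opprB addrCA subrr addr0.
apply: vanish_belowD; first exact: vanish_below_le fF0.
by apply/vanish_belowZ/vanish_comp_sub => //; apply/IH/ltnW.
Qed.

Lemma vanish_Pseq F k i : tangent_to_id F -> vanish_below k.+1 (Pseq F k i).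
Proof.
move=> tF; elim: k => [|k IH].
  move=> m; rewrite ltnS leqn0 mdeg_eq0 => /eqP -> /=.
  by rewrite ffunE /= eq_sym mnm1_eq0.
rewrite /= !ffunE; exact: vanish_comp_sub.
Qed.

Lemma tuple_compD G1 G2 F :
  tuple_comp (G1 + G2) F = tuple_comp G1 F + tuple_comp G2 F.
Proof. by apply/ffunP => i; rewrite !ffunE fps_compD. Qed.

Lemma tuple_compZ c G F : tuple_comp (c *: G) F = c *: tuple_comp G F.
Proof. by apply/ffunP => i; rewrite !ffunE fps_compZ. Qed.

Lemma Asum_comp F k :
  tuple_comp (Asum F k) F = tuple_var R n - (-1) ^+ k *: Pseq F k.
Proof.
elim: k => [|k IH].
  rewrite /Asum big_ord0 expr0 scale1r subrr.
  (* Writing 0 as [0 *: 0] gives [T 0 = 0] from homogeneity. *)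
  by rewrite -[X in tuple_comp X](scale0r 0) tuple_compZ scale0r.
rewrite /Asum big_ord_recr /= -/(Asum F k) tuple_compD IH tuple_compZ.
by rewrite exprS mulN1r scaleNr opprK scalerBr addrA addrAC.
Qed.

Lemma vanish_Asum_sub F G k i : tangent_to_id F -> formal_inverse F G ->
  vanish_below k.+1 ((Asum F k - G) i).
Proof.
move=> tF [_ GF]; apply: (vanish_comp_inv _ _ F tF).
have /ffunP/(_ i) : tuple_comp (Asum F k - G) F = - (-1) ^+ k *: Pseq F k.
  rewrite -[- G]scaleN1r tuple_compD Asum_comp tuple_compZ GF.
  by rewrite scaleN1r addrAC subrr add0r scaleNr.
rewrite ffunE => ->; rewrite ffunE.
exact/vanish_belowZ/vanish_Pseq.
Qed.

Lemma Asum_cvg F G :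
  tangent_to_id F -> formal_inverse F G -> tuple_cvg (Asum F) G.
Proof.
(* [Asum F k - G] vanishes in all degrees up to [k], so [k >= N] already gives order greater than
   [N]. *)
move=> tF FG i N; exists N => k Nk; apply/lt_ordP => m mN.
have := vanish_Asum_sub F G k i tF FG m; rewrite !ffunE; apply.
by rewrite ltnS (leq_trans mN).
Qed.

End UnipotentSubstitution.

Theorem theorem3p4 (K : fieldType) (n : nat) (hn : (1 <= n)%N)
    (F H G : {ffun 'I_n -> fps K n})
    (hF0 : fps_vanish0 F)
    (hF : F = tuple_var K n + H)
    (hH : forall i : 'I_n, lt_ord 1 (fps_ord (H i)))
    (hG : formal_inverse F G) :
  (exists A, tuple_cvg (Asum F) A) /\
  (forall A, tuple_cvg (Asum F) A -> A = G).
Proof.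
have tF : tangent_to_id _ _ F.
  (* Up to degree 1 the series [H i] has no terms, so [F i] agrees there with [X_i]. *)
  move=> i m; rewrite mdeg1 => m1; rewrite hF !ffunE /=.
  by have /lt_ordP -> := hH i; rewrite // addr0 eq_sym.
have AG := Asum_cvg _ _ F G tF hG.
split; first by exists G.
by move=> A hA; apply/ffunP => i; apply: fps_cvg_unique (hA i) (AG i).
Qed.
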